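(* For each integer $n>1$ there exists a twisted knot $D_n$ (given by an oriented twisted knot diagram, also denoted $D_n$) whose $\mathcal{B}$-Index polynomial is $$\mathcal{B}_{D_n}(t)=2t^{4(n-1)}+2(n-1)t^4-2n .$$
   Context: Twisted diagrams. A twisted link diagram is a generic immersion of circles in the plane in which every double point is either a classical crossing (with over/under information) or a virtual crossing, together with finitely many bars (short transverse marks) placed on edges away from the crossings. A twisted knot diagram has one circle; twisted knots are equivalence classes of such diagrams under classical, virtual, semi-virtual and twisted Reidemeister moves. Sign. $\operatorname{sgn}(c)=+1$ if the under-strand direction is obtained from the over-strand direction by a counterclockwise rotation by an angle less than $\pi$, and $-1$ otherwise. Arcs. In an oriented diagram, a component with at most one bar is regarded as a single arc; otherwise the arcs of a component are its segments between two consecutive bars. For an arc $C$, $\langle C=C_1,\dots,C_n\rangle$ denotes the sequence of all arcs of the component containing $C$, in the order met when travelling along the orientation starting from $C$. Linking sets. In a two-component oriented diagram $L$, a linking crossing is a classical crossing between different components. For an arc $C$, $\mathcal{O}(C)$ (resp. $\mathcal{U}(C)$) is the set of linking crossings met as overcrossings (resp. undercrossings) when traversing $C$. With $\langle C=C_1,\dots,C_n\rangle$ the sequence of all arcs of the component of $L$ containing $C$, in the order met when travelling along the orientation starting from $C$, $\mathcal{O}_L(L:C)=\mathcal{O}(C_1)\cup\mathcal{U}(C_2)\cup\mathcal{O}(C_3)\cup\cdots$ and $\mathcal{U}_L(L:C)=\mathcal{U}(C_1)\cup\mathcal{O}(C_2)\cup\mathcal{U}(C_3)\cup\cdots$, alternating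 through $C_n$. Indices. Let $c$ be a classical crossing of an oriented twisted knot diagram $D$. Put a base point $\alpha$ on the incoming part of the under strand and a base point $\beta$ on the incoming part of the over strand, both immediately before $c$. Smoothing $c$ along the orientation (incoming under strand joined to outgoing over strand, incoming over strand joined to outgoing under strand) gives an oriented two-component diagram $D_c$. Let $C$, $C'$ be the arcs of $D_c$ containing $\alpha$, $\beta$ respectively. Then $\operatorname{Ind}^1(c)=\sum_{x\in\mathcal{O}_L(D_c:C)}\operatorname{sgn}(x)-\sum_{x\in\mathcal{U}_L(D_c:C)}\operatorname{sgn}(x)$, and $\operatorname{Ind}^2(c)$ is the same expression with $C'$ in place of $C$. $\mathcal{B}$-Index polynomial. $\mathcal{B}_D(t)=\sum_{c\in\mathcal{C}(D)}\operatorname{sgn}(c)\left(t^{\operatorname{Ind}^1(c)+\operatorname{Ind}^2(c)}-1\right)$, where $\mathcal{C}(D)$ is the set of classical crossings of $D$. *)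

(* Defs.v *)
From HB Require Import structures.
From mathcomp Require Import all_boot all_order all_algebra.
From mathcomp Require Import all_classical all_reals all_analysis.
Set Implicit Arguments.
Unset Strict Implicit.
Unset Printing Implicit Defensive.
Import Order.TTheory GRing.Theory Num.Theory.
Import numFieldNormedType.Exports.
Local Open Scope ring_scope.

(* det (v(s), v(t)) for the velocity v of the plane curve (x, y); when nonzero,
   it is positive iff v(t) is obtained from v(s) by a counterclockwise
   rotation by an angle less than pi (up to a positive scaling). *)
Definition velocity_det (R : realType) (x y : R -> R) (s t : R) : R :=
  derive1 x s * derive1 y t - derive1 y s * derive1 x t.

(* An oriented twisted knot diagram: a generic C^oo immersion of the circle R/Z
   in the plane, given by two 1-periodic coordinate functions, with the
   orientation of increasing parameter.  A double point is the pair of its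
   parameters in [0, 1); for a classical crossing the first one is the
   parameter of the over strand and the second one that of the under strand.
   Distinctness of all the listed parameters excludes triple points and bars
   placed at crossings. *)
Record twisted_knot_diagram (R : realType) := TwistedKnotDiagram {
  xcoord : R -> R ;
  ycoord : R -> R ;
  classical : seq (R * R) ;
  virtual : seq (R * R) ;
  bars : seq R ;
  xcoord_periodic : periodic xcoord 1 ;
  ycoord_periodic : periodic ycoord 1 ;
  xcoord_smooth : forall (k : nat) (t : R), derivable (derive1n k xcoord) t 1 ;
  ycoord_smooth : forall (k : nat) (t : R), derivable (derive1n k ycoord) t 1 ;
  immersed : forall t : R, (derive1 xcoord t, derive1 ycoord t) <> (0, 0) ;
  double_points : forall s t : R, 0 <= s < 1 -> 0 <= t < 1 -> s <> t ->
    ((xcoord s, ycoord s) = (xcoord t, ycoord t) <->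
    ((s, t) \in classical ++ virtual) || ((t, s) \in classical ++ virtual)) ;
  transverse : forall p : R * R, p \in classical ++ virtual ->
    velocity_det xcoord ycoord p.1 p.2 <> 0 ;
  params_range : forall t : R,
    t \in map fst (classical ++ virtual) ++ map snd (classical ++ virtual)
          ++ bars -> 0 <= t < 1 ;
  params_uniq :
    uniq (map fst (classical ++ virtual) ++ map snd (classical ++ virtual)
          ++ bars)
}.

Definition crossing_sgn (R : realType) (D : twisted_knot_diagram R)
    (c : R * R) : int :=
  sgz (velocity_det (xcoord D) (ycoord D) c.1 c.2).

(* What the linking sets see of an oriented two-component diagram: the
   parameters of the classical passages and of the bars met along each
   component.  A component is a closed curve listed from a base point lying
   between the last and the first entry of its list.  Virtual crossings play no
   role here and are not recorded. *)
Record two_component_diagram (R : realType) := TwoComponentDiagram {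
  component1 : seq R ;
  component2 : seq R ;
  crossings : seq (R * R) ;
  link_bars : seq R
}.

Definition linking_crossings (R : realType) (L : two_component_diagram R) :
    seq (R * R) :=
  [seq x <- crossings L |
     (x.1 \in component1 L) && (x.2 \in component2 L)
     || (x.1 \in component2 L) && (x.2 \in component1 L)].

Fixpoint cut_at (R : realType) (B K : seq R) : seq (seq R) :=
  if K is t :: K' then
    let ss := cut_at B K' in
    if t \in B then [::] :: ss else (t :: head [::] ss) :: behead ss
  else [:: [::]].

(* The arcs of a component, in the order of the orientation, starting with the
   arc containing the base point: the stretch after the last bar and the
   stretch before the first one are joined through the base point, and there
   is a single arc when the component has at most one bar (at most two
   stretches). *)
Definition arcs (R : realType) (B K : seq R) : seq (seq R) :=
  match cut_at B K with
  | s0 :: s1 :: s2 :: ss => (last s2 ss ++ s0) :: s1 :: belast s2 ss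
  | ss => [:: flatten ss]
  end.

Definition over_on (R : realType) (C : seq R) (x : R * R) : bool := x.1 \in C.
Definition under_on (R : realType) (C : seq R) (x : R * R) : bool := x.2 \in C.

(* Membership in P(C_1) \/ Q(C_2) \/ P(C_3) \/ ... *)
Fixpoint alternating (R : realType) (P Q : seq R -> R * R -> bool)
    (Cs : seq (seq R)) (x : R * R) : bool :=
  if Cs is C :: Cs' then P C x || alternating Q P Cs' x else false.

(* O_L(L : C) and U_L(L : C), where Cs = <C = C_1, ..., C_n>. *)
Definition O_L (R : realType) (L : two_component_diagram R)
    (Cs : seq (seq R)) : seq (R * R) :=
  [seq x <- linking_crossings L | alternating (@over_on R) (@under_on R) Cs x].

Definition U_L (R : realType) (L : two_component_diagram R)
    (Cs : seq (seq R)) : seq (R * R) :=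
  [seq x <- linking_crossings L | alternating (@under_on R) (@over_on R) Cs x].

(* Parameters of the classical passages and of the bars, in the order in which
   the knot meets them. *)
Definition route (R : realType) (D : twisted_knot_diagram R) : seq R :=
  sort <=%R (map fst (classical D) ++ map snd (classical D) ++ bars D).

(* The entries of the route met strictly between leaving s and next reaching t,
   in cyclic order. *)
Definition route_between (R : realType) (D : twisted_knot_diagram R)
    (s t : R) : seq R :=
  let w := rot (index s (route D)).+1 (route D) in take (index t w) w.

(* The oriented smoothing D_c.  The component containing alpha leaves c on the
   over strand and comes back on the under strand; the component containing
   beta leaves on the under strand and comes back on the over strand.  Since
   alpha and beta are immediately before c, each component is listed from its
   base point.  All orientations are inherited from D, hence so are the signs
   of the remaining crossings. *)
Definition smoothing (R : realType) (D : twisted_knot_diagram R)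
    (c : R * R) : two_component_diagram R :=
  {| component1 := route_between D c.1 c.2 ;
     component2 := route_between D c.2 c.1 ;
     crossings := rem c (classical D) ;
     link_bars := bars D |}.

Definition linking_index (R : realType) (D : twisted_knot_diagram R)
    (L : two_component_diagram R) (Cs : seq (seq R)) : int :=
  \sum_(x <- O_L L Cs) crossing_sgn D x - \sum_(x <- U_L L Cs) crossing_sgn D x.

Definition Ind1 (R : realType) (D : twisted_knot_diagram R) (c : R * R) : int :=
  let L := smoothing D c in
  linking_index D L (arcs (link_bars L) (component1 L)).

Definition Ind2 (R : realType) (D : twisted_knot_diagram R) (c : R * R) : int :=
  let L := smoothing D c in
  linking_index D L (arcs (link_bars L) (component2 L)).

(* Laurent polynomials Z[t, t^-1] are taken inside the fraction field of Z[t]. *)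
Definition tvar : {fraction {poly int}} := tofrac 'X.

Definition B_index_polynomial (R : realType) (D : twisted_knot_diagram R) :
    {fraction {poly int}} :=
  \sum_(c <- classical D)
    (crossing_sgn D c)%:~R * (tvar ^ (Ind1 D c + Ind2 D c) - 1).

(* Main.v *)
Require Import Defs.
From mathcomp Require Import all_boot all_order all_algebra.
From mathcomp Require Import all_classical all_reals all_analysis.
From mathcomp Require Import zify ring lra.
Set Implicit Arguments.
Unset Strict Implicit.
Unset Printing Implicit Defensive.
Import Order.TTheory GRing.Theory Num.Theory.
Import numFieldNormedType.Exports.
Local Open Scope ring_scope.

(* The index sum of a crossing c only depends on the underlying flat diagram and
   on the bars: exchanging over and under at a linking crossing x changes both
   sgn(x) and the linking set containing x, and exchanging them at c swaps Ind^1
   and Ind^2.  So it is enough to find a plane curve with a family A of 2 and a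
   family B of 2(n-1) double points such that the chords of a family are
   pairwise disjoint while every A-chord meets every B-chord, and to place bars
   so that all linking crossings count with the same sign; all other double
   points are made virtual and all signs are chosen positive.

   Let q = n - 1 and b = 8q + 1.  The Lissajous curve
     t |-> (cos (4 pi t), cos (2 pi b t + pi/4))
   has all its double points at parameters p/(8b).  Besides b diameters
   s - t = 1/2, they are the chords s + t = 0 and s + t = 1/2 (mod 1) with
   s - t in Z/b: two parallel families crossing each other.  A consists of the
   two chords of the first family nearest to its middle, B of those chords of
   the second family near its middle at which the first passage has the same
   transversal direction.  The knot meets B, A, then the far ends of B, then the
   far ends of A; bars are put between these groups, except between B and A. *)

(** * Waves *)

Section Trigonometry.
Variable R : realType.
Implicit Types (x u v w c : R) (d k p r : nat).

Definition wave w c (t : R) : R := cos (w * t + c).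

Lemma is_derive_wave w c (a t : R) :
  is_derive t 1 (fun t => a * wave w c t) (a * w * wave w (c + pi / 2) t).
Proof.
have h1 : is_derive t 1 (fun t : R => w * t + c) w.
  have := is_deriveD (is_deriveZ w (is_derive_id t 1)) (is_derive_cst c t 1).
  by rewrite addr0 /GRing.scale /= mulr1.
have := is_deriveZ a (@is_derive1_comp _ _ _ t _ _
  (is_derive_cos (w * t + c)) h1).
rewrite /wave addrA cosDpihalf => h2.
by apply: is_derive_eq h2 _; rewrite /GRing.scale /=; ring.
Qed.

Lemma derive1_wave w c (a : R) :
  derive1 (fun t => a * wave w c t) = (fun t => a * w * wave w (c + pi / 2) t).
Proof.
by apply/funext => t; rewrite derive1E; have [_ ->] := is_derive_wave w c a t.
Qed.

(** Differentiating a wave only rescales it and shifts its phase by pi/2, so the family of multiples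
    of waves of frequency [w] is stable; this gives smoothness at every order. *)
Lemma derive1n_wave w c k : exists a c',
  derive1n k (wave w c) = (fun t => a * wave w c' t).
Proof.
elim: k => [|k [a [c' IH]]].
  by exists 1, c; apply/funext => t; rewrite mul1r.
by exists (a * w), (c' + pi / 2); rewrite derive1nS IH derive1_wave.
Qed.

Lemma smooth_wave w c k (t : R) : derivable (derive1n k (wave w c)) t 1.
Proof.
have [a [c' ->]] := derive1n_wave w c k.
by have [] := is_derive_wave w c' a t.
Qed.

Lemma velocity_wave w c (t : R) :
  derive1 (wave w c) t = - (w * sin (w * t + c)).
Proof.
have -> : wave w c = (fun t => 1 * wave w c t).
  by apply/funext => s; rewrite mul1r.
by rewrite derive1_wave /wave addrA cosDpihalf mul1r mulrN.
Qed.

Lemma periodic_wave c k : periodic (wave ((2 * k)%:R * pi) c) 1.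
Proof.
move=> t; rewrite /wave mulrDr mulr1 addrAC.
rewrite -[in RHS](periodicn (@cosD2pi R) k); congr (cos (_ + _)).
by rewrite -mulrnA mulr_natl.
Qed.

(** Subtracting floor(x / pi) times pi leaves a remainder in [0, pi), where the sine vanishes only
    at 0. *)
Lemma sin_eq0_int x : sin x = 0 -> exists k : int, x = k%:~R * pi.
Proof.
move=> sx0; exists (Num.floor (x / pi)).
have p0 := pi_gt0 R.
have := floor_itv (x / pi).
set k := Num.floor (x / pi); rewrite intrD => /andP[kx xk].
apply/eqP; rewrite -subr_eq0.
have skx : sin (x - k%:~R * pi) = 0.
  (* Alternation is available for natural multiples of pi, hence the split on the sign of [k]. *)
  case: k {kx xk} => n.
    have := alternatingn (@sinDpi R) n (x - n%:~R * pi).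
    rewrite -[pi *+ n]mulr_natl subrK sx0 => /esym/eqP.
    by rewrite mulf_eq0 signr_eq0 => /eqP.
  have := alternatingn (@sinDpi R) n.+1 x.
  by rewrite sx0 mulr0 NegzE mulrNz mulNr opprK -[pi *+ _]mulr_natl.
have : 0 <= x - k%:~R * pi by rewrite subr_ge0 -ler_pdivlMr.
rewrite le_eqVlt => /orP[/eqP<-//|h].
have : 0 < sin (x - k%:~R * pi).
  apply: sin_gt0_pi; rewrite h ltrBlDl.
  by have := xk; rewrite ltr_pdivrMr// mulrDl mul1r.
by rewrite skx ltxx.
Qed.

(** With half-sum [h] and half-difference [d], cos u - cos v = -2 sin h sin d, so one of the two
    sines vanishes. *)
Lemma cos_eq_int u v : cos u = cos v ->
  exists k : int, u = v + k%:~R * (2 * pi) \/ u = - v + k%:~R * (2 * pi).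
Proof.
move=> uv; pose h := (u + v) / 2; pose d := (u - v) / 2.
have uE : u = h + d by rewrite /h /d; field.
have vE : v = h - d by rewrite /h /d; field.
have : sin h * sin d = 0.
  by move: uv; rewrite uE vE cosD cosB; lra.
move=> /eqP; rewrite mulf_eq0 => /orP[] /eqP/sin_eq0_int[k kE]; exists k.
  by right; rewrite uE vE kE; ring.
by left; rewrite uE vE kE; ring.
Qed.

(** At the parameters of double points all angles are fractions of pi. Indexing them by naturals
    turns the symmetries of sine and cosine into arithmetic that [lia] decides. *)
Definition sinf d p : R := sin (pi * (p%:R / d%:R)).
Definition cosf d p : R := cos (pi * (p%:R / d%:R)).

Lemma angle_addn d k p : (0 < d)%N ->
  pi * ((p + d * k)%:R / d%:R) = pi * (p%:R / d%:R) + pi *+ k :> R.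
Proof.
move=> d0; have : d%:R != 0 :> R by rewrite pnatr_eq0 -lt0n.
by rewrite -[pi *+ k]mulr_natl natrD natrM => ?; field.
Qed.

Lemma sinf_add d k p : (0 < d)%N -> sinf d (p + d * k) = (-1) ^+ k * sinf d p.
Proof.
by move=> d0; rewrite /sinf angle_addn// (alternatingn (@sinDpi R)).
Qed.

Lemma angle_opp d k p r : (0 < d)%N -> (p + r = 2 * d * k)%N ->
  pi * (r%:R / d%:R) = - (pi * (p%:R / d%:R)) + pi *+ 2 *+ k :> R.
Proof.
move=> d0 prE; have : d%:R != 0 :> R by rewrite pnatr_eq0 -lt0n.
have -> : r%:R = 2 * d%:R * k%:R - p%:R :> R.
  by rewrite -!natrM -prE natrD addrC addKr.
by rewrite -mulrnA -[pi *+ _]mulr_natl natrM => ?; field.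
Qed.

(** The two angles add up to [k] full turns. The hypothesis is a sum, which avoids truncated
    subtraction. *)
Lemma sinf_opp d k p r : (0 < d)%N -> (p + r = 2 * d * k)%N ->
  sinf d r = - sinf d p.
Proof.
move=> d0 prE.
by rewrite /sinf (angle_opp d0 prE) (periodicn (@sinD2pi R)) sinN.
Qed.

Lemma cosf_opp d k p r : (0 < d)%N -> (p + r = 2 * d * k)%N ->
  cosf d r = cosf d p.
Proof.
move=> d0 prE.
by rewrite /cosf (angle_opp d0 prE) (periodicn (@cosD2pi R)) cosN.
Qed.

Lemma cosf_add d k p : (0 < d)%N -> cosf d (p + 2 * d * k) = cosf d p.
Proof.
move=> d0; rewrite /cosf mulnAC mulnC angle_addn// mulrnA.
exact: (periodicn (@cosD2pi R)).
Qed.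

Lemma sinf_gt0 d p : (0 < p < d)%N -> 0 < sinf d p.
Proof.
move=> /andP[p0 pd]; have d0 : 0 < d%:R :> R by rewrite ltr0n; lia.
have pi0 := pi_gt0 R; apply: sin_gt0_pi.
have pd1 : p%:R / d%:R < 1 :> R by rewrite ltr_pdivrMr// mul1r ltr_nat.
have pd0 : 0 < p%:R / d%:R :> R by rewrite divr_gt0// ltr0n.
by rewrite mulr_gt0//= gtr_pMr.
Qed.

Lemma sinf_neq0 d p : (0 < d)%N -> ~~ (d %| p)%N -> sinf d p != 0.
Proof.
move=> d0 dp; rewrite (divn_eq p d) addnC mulnC sinf_add// mulf_eq0 negb_or.
rewrite signr_eq0/= gt_eqF// sinf_gt0// ltn_mod d0 andbT.
by move: dp; rewrite /dvdn lt0n.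
Qed.

End Trigonometry.

(** * The Lissajous curve *)

Section Curve.
Variables (R : realType) (q : nat).
Let b := (8 * q).+1.
Let N := (8 * b)%N.

Definition param (p : nat) : R := p%:R / N%:R.

Let N_gt0 : 0 < N%:R :> R. Proof. by rewrite ltr0n. Qed.

Lemma ltr_param (p r : nat) : (param p < param r) = (p < r)%N.
Proof. by rewrite /param ltr_pM2r ?invr_gt0// ltr_nat. Qed.

Lemma ler_param (p r : nat) : (param p <= param r) = (p <= r)%N.
Proof. by rewrite leNgt ltr_param -leqNgt. Qed.

Lemma param_inj : injective param.
Proof.
by move=> p r /eqP; rewrite eq_le !ler_param -eqn_leq => /eqP.
Qed.

Lemma param_range p : (p < N)%N -> 0 <= param p < 1.
Proof. by move=> pN; rewrite divr_ge0//= ltr_pdivrMr// mul1r ltr_nat. Qed.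

Definition xc : R -> R := wave ((2 * 2)%:R * pi) 0.
Definition yc : R -> R := wave ((2 * b)%:R * pi) (pi / 4).

Lemma x_angle p : (2 * 2)%:R * pi * param p + 0 = pi * (p%:R / (2 * b)%:R).
Proof.
have : b%:R != 0 :> R by rewrite pnatr_eq0.
by rewrite /param !natrM addr0; move: b%:R => B Bn0; field.
Qed.

(** The phase pi/4 becomes the shift from [p] to [p.+1]. *)
Lemma y_angle p : (2 * b)%:R * pi * param p + pi / 4 = pi * (p.+1%:R / 4%:R).
Proof.
have : b%:R != 0 :> R by rewrite pnatr_eq0.
by rewrite /param -(addn1 p) natrD !natrM; move: b%:R => B Bn0; field.
Qed.

Lemma xc_param p : xc (param p) = cosf R (2 * b) p.
Proof. by rewrite /xc /wave x_angle. Qed.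

Lemma yc_param p : yc (param p) = cosf R 4 p.+1.
Proof. by rewrite /yc /wave y_angle. Qed.

Definition speed_factor (p r : nat) : R :=
  sinf R (2 * b) p * sinf R 4 r.+1 - sinf R 4 p.+1 * sinf R (2 * b) r.

Lemma velocity_det_param p r : exists2 k : R, 0 < k &
  velocity_det xc yc (param p) (param r) = k * speed_factor p r.
Proof.
(* The factor is the product of the two angular frequencies. *)
exists ((2 * 2)%:R * pi * ((2 * b)%:R * pi)).
  by rewrite !mulr_gt0// ?pi_gt0// ltr0n.
rewrite /velocity_det /xc /yc !velocity_wave !x_angle !y_angle.
by rewrite /speed_factor /sinf; ring.
Qed.

(* Diameters, then chords with s + t = 1, then chords with s + t = 1/2 or 3/2. *)
Definition double_pair (p r : nat) : bool :=
  [&& (p < r)%N, (r < N)%N &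
   [|| (p %% 4 == 1) && (r == p + 4 * b),
       [&& p %% 4 == 0, 0 < p & p + r == 8 * b] |
       (p %% 4 == 2) && ((p + r == 4 * b) || (p + r == 12 * b))]]%N.

(* In the first case the two velocities have the same x-component and opposite
   y-components, in the other two cases it is the other way round. *)
Lemma speed_factorE p r : double_pair p r ->
  speed_factor p r = (if (p %% 4 == 1)%N then -2 else 2)
    * (sinf R (2 * b) p * sinf R 4 p.+1).
Proof.
move=> /and3P[pr rN /or3P[/andP[p1 /eqP rE]|/and3P[p0 pp /eqP rE]|]].
3: move=> /andP[p2 rE].
- rewrite p1 /speed_factor.
  have -> : sinf R (2 * b) r = sinf R (2 * b) p.
    rewrite (_ : r = p + 2 * b * 2)%N; last by lia.
    by rewrite sinf_add// expr2 mulN1r opprK mul1r.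
  (* The y-angle advances by b pi, and b = 8q + 1 is odd. *)
  have -> : sinf R 4 r.+1 = - sinf R 4 p.+1.
    rewrite (_ : r.+1 = p.+1 + 4 * (8 * q).+1)%N; last by rewrite /b; lia.
    by rewrite sinf_add// -signr_odd /= oddM/= expr1 mulN1r.
  by ring.
- have -> : (p %% 4 == 1)%N = false by lia.
  rewrite /speed_factor.
  have -> : sinf R (2 * b) r = - sinf R (2 * b) p.
    by apply: (@sinf_opp _ _ 2); lia.
  (* Here 8 divides [r - p], so the y-angle advances by whole turns; the same holds in the last case
     because b is odd. *)
  have -> : sinf R 4 r.+1 = sinf R 4 p.+1.
    rewrite (_ : r.+1 = p.+1 + 4 * (2 * ((r - p) %/ 8)))%N;
      last by rewrite /b in rE *; lia.
    by rewrite sinf_add// exprM sqrrN expr1n expr1n mul1r.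
  by ring.
- have -> : (p %% 4 == 1)%N = false by lia.
  rewrite /speed_factor.
  have -> : sinf R (2 * b) r = - sinf R (2 * b) p.
    by case/orP: rE => rE; [apply: (@sinf_opp _ _ 1)|apply: (@sinf_opp _ _ 3)];
      lia.
  have -> : sinf R 4 r.+1 = sinf R 4 p.+1.
    rewrite (_ : r.+1 = p.+1 + 4 * (2 * ((r - p) %/ 8)))%N;
      last by rewrite /b in rE *; lia.
    by rewrite sinf_add// exprM sqrrN expr1n expr1n mul1r.
  by ring.
Qed.

Lemma speed_factor_neq0 p r : double_pair p r -> speed_factor p r != 0.
Proof.
move=> pr; rewrite (speed_factorE pr) !mulf_neq0//.
- by case: ifP => _; rewrite ?oppr_eq0 pnatr_eq0.
(* If p = 2bk then k < 4. The value p = 0 is excluded, and for the others the chord equation would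
   give r = p or an [r] outside [0, 8b). *)
- apply: sinf_neq0 => //; apply/negP => /dvdnP[k kE].
  have k4 : (k < 4)%N.
    rewrite -(@ltn_pmul2r (2 * b))// -kE.
    by move: pr; rewrite /double_pair /N; lia.
  move: pr; rewrite /double_pair kE /b.
  by case: k k4 {kE} => [|[|[|[|k]]]] //; lia.
- by apply: sinf_neq0 => //; move: pr; rewrite /double_pair /N /b; lia.
Qed.

Lemma double_pair_coords p r : double_pair p r ->
  (xc (param p), yc (param p)) = (xc (param r), yc (param r)).
Proof.
rewrite !xc_param !yc_param.
move=> /and3P[pr rN /or3P[/andP[p1 /eqP rE]|/and3P[p0 pp /eqP rE]|]].
3: move=> /andP[p2 rE].
- rewrite (_ : cosf R (2 * b) r = cosf R (2 * b) p).
  2: by rewrite (_ : r = p + 2 * (2 * b) * 1)%N ?cosf_add//; lia.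
  rewrite (@cosf_opp _ 4 ((p + r + 2) %/ 8) p.+1 r.+1)//.
  by rewrite /b in rE *; lia.
- rewrite (@cosf_opp _ (2 * b) 2 p r)//; last by lia.
  rewrite (_ : r.+1 = p.+1 + 2 * 4 * ((r - p) %/ 8))%N ?cosf_add//.
  by rewrite /b in rE *; lia.
- have -> : cosf R (2 * b) r = cosf R (2 * b) p.
    by case/orP: rE => rE; [apply: (@cosf_opp _ _ 1)|apply: (@cosf_opp _ _ 3)];
      lia.
  rewrite (_ : r.+1 = p.+1 + 2 * 4 * ((r - p) %/ 8))%N ?cosf_add//.
  by rewrite /b in rE *; lia.
Qed.

(** If both components vanished, 4t = k and 8bt + 1 = 4l would be integers, so 2bk + 1 = 4l, against
    parity. *)
Lemma immersed_curve (t : R) : (derive1 xc t, derive1 yc t) <> (0, 0).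
Proof.
have p0 : pi != 0 :> R by rewrite gt_eqF// pi_gt0.
rewrite !velocity_wave => -[] /eqP; rewrite oppr_eq0 mulf_eq0 mulf_eq0.
rewrite pnatr_eq0/= (negbTE p0)/= => /eqP/sin_eq0_int[k kE].
move=> /eqP; rewrite oppr_eq0 mulf_eq0 mulf_eq0.
rewrite pnatr_eq0/= (negbTE p0)/= => /eqP/sin_eq0_int[l lE].
have {}kE : 4 * t = k%:~R.
  by apply: (mulIf p0); rewrite -kE; ring.
have {}lE : (8 * b)%:R * t + 1 = (4 * l)%:~R.
  by apply: (mulIf p0); move: lE; rewrite intrM !natrM; lra.
have : (2 * b%:Z * k + 1)%:~R = (4 * l)%:~R :> R.
  by rewrite -lE intrD !intrM -kE !natrM; ring.
by move=> /eqP; rewrite eqr_int => /eqP; rewrite /b; lia.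
Qed.

Lemma param_int (s : R) (k : int) : 0 <= s < 1 -> N%:R * s = k%:~R ->
  exists2 p : nat, (p < N)%N & k = p /\ s = param p.
Proof.
move=> /andP[s0 s1] sk; have k0 : 0 <= k.
  by rewrite -(ler0z R) -sk mulr_ge0// ltW.
case: k k0 sk => // p _ sk.
have sE : s = param p.
  by rewrite /param -[p%:R]/(p%:~R) -sk mulrAC mulfV ?mul1r// gt_eqF.
exists p => //; move: s1; rewrite sE /param ltr_pdivrMr// mul1r ltr_nat//.
Qed.

(** Equality of cosines in each coordinate leaves a choice of sign for each, hence four cases: two
    are impossible, one gives the diameters and one the two parallel families. *)
Lemma double_pair_complete (s t : R) : 0 <= s < 1 -> 0 <= t < 1 -> s <> t ->
  (xc s, yc s) = (xc t, yc t) -> exists p r, double_pair p r /\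
  ((s, t) = (param p, param r) \/ (t, s) = (param p, param r)).
Proof.
move=> s01 t01 st [xst yst].
have p0 : pi != 0 :> R by rewrite gt_eqF// pi_gt0.
suff [k [l [sk tl klP]]] : exists k l : int, [/\ N%:R * s = k%:~R,
    N%:R * t = l%:~R & [\/ (l = k + 4 * b%:Z /\ (k %% 4 = 1)%Z),
      (k = l + 4 * b%:Z /\ (l %% 4 = 1)%Z) | exists2 j : int, k = l + 8 * j &
       [\/ k + l = 4 * b%:Z, k + l = 8 * b%:Z | k + l = 12 * b%:Z]]].
  have [p pN [kp sp]] := param_int s01 sk.
  have [r rN [lr tr]] := param_int t01 tl.
  have pr : p <> r by move=> pr; apply: st; rewrite sp tr pr.
  rewrite {}kp {}lr in klP.
  case: (ltnP p r) => prlt; [exists p, r; split; last by left; rewrite sp tr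
                       |exists r, p; split; last by right; rewrite sp tr].
    rewrite /double_pair prlt rN /= /b; rewrite /b in klP.
    by case: klP => [|?|[j ? []]]; lia.
  rewrite /double_pair ltn_neqAle prlt pN andbT /= /b; rewrite /b in klP.
  by case: klP => [?||[j ? []]]; lia.
have [k xk] := cos_eq_int xst; have [l yl] := cos_eq_int yst.
have {}xk : 2 * s = 2 * t + k%:~R \/ 2 * s = - (2 * t) + k%:~R.
  by case: xk => xk; [left|right]; apply: (mulIf p0); move: xk; rewrite !natrM;
    lra.
have {}yl : N%:R * s = N%:R * t + (8 * l)%:~R \/
    N%:R * s = - (N%:R * t) + (8 * l - 2)%:~R.
  case: yl => yl; [left|right]; apply: (mulIf p0); move: yl;
  by rewrite /N !natrM !(intrD,intrM,intrN); lra.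
have bNR : N%:R = 8 * b%:R :> R by rewrite natrM.
have bZR : b%:R = b%:Z%:~R :> R by [].
move: (s01) (t01) => /andP[s0 s1] /andP[t0 t1].
have int_lt (m : int) (z : int) : (m%:~R < z%:~R :> R) -> (m < z)%R.
  by rewrite ltr_int.
have int_eq (m z : int) : m%:~R = z%:~R :> R -> m = z.
  by move=> /eqP; rewrite eqr_int => /eqP.
case: xk yl => xk [] yl.
(* Same sign twice: b is odd, so [k] is even, and |k| < 2 forces s = t. *)
- have kl : b%:Z * k = 2 * l.
    by apply: int_eq; rewrite !intrM -bZR; move: yl; rewrite bNR !intrM; nra.
  have k2 : k < 2 by apply: int_lt; lra.
  have k2' : -2 < k by apply: int_lt; rewrite intrN; lra.
  have k0 : k = 0 by move: kl; rewrite /b; nia.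
  by case: st; rewrite k0 in xk; lra.
(* Here s - t = k/2 with k = 1 or -1: a diameter. *)
- exists (4 * l - 1 + 2 * b%:Z * k), (4 * l - 1 - 2 * b%:Z * k); split.
  + rewrite !(intrD,intrN,intrM) -bZR; move: yl;
      rewrite bNR !(intrD,intrN,intrM); nra.
  + rewrite !(intrD,intrN,intrM) -bZR; move: yl;
      rewrite bNR !(intrD,intrN,intrM); nra.
  have k2 : k < 2 by apply: int_lt; lra.
  have k2' : -2 < k by apply: int_lt; rewrite intrN; lra.
  have k0 : k <> 0 by move=> k0; case: st; rewrite k0 in xk; lra.
  have [->|->] : k = 1 \/ k = -1 by lia.
    by apply: Or32; rewrite /b; split; lia.
  by apply: Or31; rewrite /b; split; lia.
(* Here s + t = k/2 with k = 1, 2 or 3; k = 0 would give s = t = 0. *)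
- exists (2 * b%:Z * k + 4 * l), (2 * b%:Z * k - 4 * l); split.
  + rewrite !(intrD,intrN,intrM) -bZR; move: yl;
      rewrite bNR !(intrD,intrN,intrM); nra.
  + rewrite !(intrD,intrN,intrM) -bZR; move: yl;
      rewrite bNR !(intrD,intrN,intrM); nra.
  apply: Or33; exists l; first by ring.
  have k4 : k < 4 by apply: int_lt; lra.
  have k0 : -1 < k by apply: int_lt; rewrite intrN; lra.
  have kn0 : k <> 0 by move=> k0'; case: st; rewrite k0' in xk; lra.
  have [->|[->|->]] : k = 1 \/ k = 2 \/ k = 3 by lia.
  + by apply: Or31; ring.
  + by apply: Or32; ring.
  + by apply: Or33; ring.
(* Opposite signs twice: impossible modulo 4, thanks to the phase. *)
- have : 4 * b%:Z * k = 8 * l - 2.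
    apply: int_eq; rewrite !(intrD,intrN,intrM) -bZR; move: yl.
    by rewrite bNR !(intrD,intrN,intrM); nra.
  by rewrite /b; lia.
Qed.

End Curve.

(** * The diagram *)

Section Diagram.
Variables (R : realType) (q : nat).
Let b := (8 * q).+1.
Let N := (8 * b)%N.

Definition double_pairs : seq (nat * nat) :=
  [seq x <- [seq (p, r) | p <- iota 0 N, r <- iota 0 N]
     | double_pair q x.1 x.2].

Lemma mem_double_pairs x : (x \in double_pairs) = double_pair q x.1 x.2.
Proof.
rewrite mem_filter; case dx: (double_pair _ _ _); rewrite ?andTb ?andFb//.
case: x dx => p r dx; have /and3P[pr rN _] : double_pair q p r by [].
by apply/allpairsPdep; exists p, r; rewrite !mem_iota; split=> //; move: pr rN;
  rewrite /N /b; lia.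
Qed.

Lemma uniq_double_pairs : uniq double_pairs.
Proof.
rewrite filter_uniq// allpairs_uniq ?iota_uniq//.
by move=> [p r] [p' r'] _ _ /= [-> ->].
Qed.

Definition chordsA : seq (nat * nat) :=
  [:: (16 * q, 48 * q + 8); (16 * q + 4, 48 * q + 4)]%N.

(* Only every second chord near the middle of its family is taken: consecutive
   ones cross in opposite directions. *)
Definition chordsB : seq (nat * nat) :=
  [seq (8 * i + 2, 32 * q + 2 - 8 * i)%N | i <- iota 0 (2 * q)].
Definition chords := chordsA ++ chordsB.
Definition virtual_chords := [seq x <- double_pairs | x \notin chords].

(* No double point has a parameter congruent to 3 modulo 4. *)
Definition bar_points : seq nat := [:: 16 * q + 7; 48 * q + 3; 48 * q + 11]%N.

Hypothesis q_gt0 : (0 < q)%N.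

Lemma chordsBP x : reflect (exists2 i, (i < 2 * q)%N &
   x = (8 * i + 2, 32 * q + 2 - 8 * i)%N) (x \in chordsB).
Proof.
apply: (iffP mapP) => -[i]; first by rewrite mem_iota => ? ?; exists i.
by move=> ? ->; exists i; rewrite ?mem_iota.
Qed.

Lemma chords_double_pair x : x \in chords -> double_pair q x.1 x.2.
Proof.
rewrite mem_cat !inE -orbA => /or3P[/eqP->|/eqP->|/chordsBP[i iq ->]];
by rewrite /double_pair /=; lia.
Qed.

Lemma uniq_chords : uniq chords.
Proof.
rewrite cat_uniq; apply/and3P; split.
- by rewrite /= !inE !andbT xpair_eqE; lia.
- apply/hasPn => x /chordsBP[i iq ->].
  by rewrite !inE !xpair_eqE; lia.
- by rewrite map_inj_uniq ?iota_uniq// => i j [] /=; lia.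
Qed.

Lemma perm_chords_virtual_chords :
  perm_eq (chords ++ virtual_chords) double_pairs.
Proof.
apply: uniq_perm => [||x].
- rewrite cat_uniq uniq_chords filter_uniq ?uniq_double_pairs// andbT.
  by apply/hasPn => x; rewrite mem_filter => /andP[].
- exact: uniq_double_pairs.
- rewrite mem_cat mem_filter; case: (boolP (x \in chords)) => //= xC.
  by rewrite mem_double_pairs chords_double_pair.
Qed.

(** The residue modulo 4 of a parameter (1, 0 or 2) tells the kind of its chord, and the kind
    determines the other end. So there is no triple point, and residue 3 is free for the bars. *)
Lemma uniq_double_params :
  uniq (map fst double_pairs ++ map snd double_pairs ++ bar_points).
Proof.
have dP x : x \in double_pairs -> double_pair q x.1 x.2.
  by rewrite mem_double_pairs.
rewrite cat_uniq; apply/and3P; split; last first.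
- rewrite cat_uniq; apply/and3P; split.
  + rewrite map_inj_in_uniq ?uniq_double_pairs//.
    move=> [p r] [p' r'] /dP/= + /dP/= + /= pp'; rewrite -pp' /double_pair.
    by move=> h1 h2; congr pair; lia.
  + apply/hasPn => p pm; apply/mapP => -[[s r] /dP/= + /= E].
    by rewrite -E; move: pm; rewrite !inE /double_pair; lia.
  + by rewrite /= !inE; lia.
- apply/hasPn => p; rewrite mem_cat => /orP[/mapP[[s r] /dP/= sr ->]|pm];
    apply/mapP => -[[s' r'] /dP/= sr' /= E]; move: sr'; rewrite -E.
    by move: sr; rewrite /double_pair; lia.
  by move: pm; rewrite !inE /double_pair; lia.
- rewrite map_inj_in_uniq ?uniq_double_pairs//.
  move=> [p r] [p' r'] /dP/= + /dP/= + /= pp'; rewrite -pp' /double_pair.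
  by move=> h1 h2; congr pair; lia.
Qed.

Definition param2 (x : nat * nat) : R * R := (param R q x.1, param R q x.2).

Lemma param2_inj : injective param2.
Proof. by move=> [p r] [p' r'] [/param_inj-> /param_inj->]. Qed.

Lemma mem_param2 (x : nat * nat) :
  (param2 x \in map param2 chords ++ map param2 virtual_chords)
  = double_pair q x.1 x.2.
Proof.
rewrite -map_cat mem_map; last exact: param2_inj.
by rewrite (perm_mem perm_chords_virtual_chords) mem_double_pairs.
Qed.

Lemma map_fst_param2 s : map fst (map param2 s) = map (param R q) (map fst s).
Proof. by rewrite -!map_comp. Qed.

Lemma map_snd_param2 s : map snd (map param2 s) = map (param R q) (map snd s).
Proof. by rewrite -!map_comp. Qed.

Lemma params_perm : perm_eq
  (map fst (map param2 chords ++ map param2 virtual_chords)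
   ++ map snd (map param2 chords ++ map param2 virtual_chords)
   ++ map (param R q) bar_points)
  (map (param R q) (map fst double_pairs ++ map snd double_pairs ++ bar_points)).
Proof.
rewrite -map_cat map_fst_param2 map_snd_param2 -!map_cat; apply: perm_map.
by apply: perm_cat; last apply: perm_cat => //; apply: perm_map;
  exact: perm_chords_virtual_chords.
Qed.

Lemma double_points_lissajous (s t : R) : 0 <= s < 1 -> 0 <= t < 1 -> s <> t ->
  ((xc s, yc q s) = (xc t, yc q t) <->
  ((s, t) \in map param2 chords ++ map param2 virtual_chords)
  || ((t, s) \in map param2 chords ++ map param2 virtual_chords)).
Proof.
move=> s01 t01 st; split=> [|/orP[]].
- move=> /(double_pair_complete s01 t01 st)[p [r [pr [->|->]]]].
    by rewrite (mem_param2 (p, r)) pr.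
  by rewrite orbC (mem_param2 (p, r)) pr.
- rewrite -map_cat => /mapP[x + [-> ->]].
  rewrite (perm_mem perm_chords_virtual_chords) mem_double_pairs.
  exact: double_pair_coords.
- rewrite -map_cat => /mapP[x + [-> ->]].
  rewrite (perm_mem perm_chords_virtual_chords) mem_double_pairs.
  by move/double_pair_coords => ->.
Qed.

Lemma transverse_lissajous p :
  p \in map param2 chords ++ map param2 virtual_chords ->
  velocity_det (@xc R) (yc q) p.1 p.2 <> 0.
Proof.
rewrite -map_cat => /mapP[x + ->].
rewrite (perm_mem perm_chords_virtual_chords) mem_double_pairs => xd.
have [k k0 ->] := velocity_det_param R q x.1 x.2.
by apply/eqP/mulf_neq0; [rewrite gt_eqF|exact: speed_factor_neq0].
Qed.

Lemma params_range_lissajous t :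
  t \in map fst (map param2 chords ++ map param2 virtual_chords)
   ++ map snd (map param2 chords ++ map param2 virtual_chords)
   ++ map (param R q) bar_points ->
  0 <= t < 1.
Proof.
rewrite (perm_mem params_perm) => /mapP[p + ->] => pin; apply: param_range.
move: pin; rewrite !mem_cat => /or3P[/mapP[[s r] + ->]|/mapP[[s r] + ->]|].
- by rewrite mem_double_pairs /double_pair/=; lia.
- by rewrite mem_double_pairs /double_pair/=; lia.
- by rewrite !inE; lia.
Qed.

Lemma params_uniq_lissajous :
  uniq (map fst (map param2 chords ++ map param2 virtual_chords)
   ++ map snd (map param2 chords ++ map param2 virtual_chords)
   ++ map (param R q) bar_points).
Proof.
rewrite (perm_uniq params_perm) map_inj_uniq ?uniq_double_params//.
exact: param_inj.
Qed.

Definition lissajous : twisted_knot_diagram R :=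
  @TwistedKnotDiagram R (@xc R) (yc q) (map param2 chords)
    (map param2 virtual_chords) (map (param R q) bar_points)
    (@periodic_wave R 0 2) (@periodic_wave R (pi / 4) b)
    (@smooth_wave R _ _) (@smooth_wave R _ _) (@immersed_curve R q)
    double_points_lissajous transverse_lissajous params_range_lissajous
    params_uniq_lissajous.

(** No chosen chord is a diameter, so [speed_factorE] reduces the sign to that of a product of two
    sines, which have equal signs at each first end. *)
Lemma crossing_sgn_lissajous x : x \in chords ->
  crossing_sgn lissajous (param2 x) = 1.
Proof.
move=> xC; apply/eqP; rewrite sgz_cp0.
have [k k0 ->] := velocity_det_param R q x.1 x.2.
rewrite mulr_gt0//= speed_factorE ?chords_double_pair//.
have -> : (x.1 %% 4 == 1)%N = false.
  move: xC; rewrite mem_cat !inE -orbA => /or3P[/eqP->|/eqP->|/chordsBP[i iq ->]] /=;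
    lia.
rewrite mulr_gt0// -/b.
have s1 p : (0 < p < 2 * b)%N -> 0 < sinf R (2 * b) p by exact: sinf_gt0.
have s2 p : (0 < p < 4)%N -> 0 < sinf R 4 p by exact: sinf_gt0.
move: xC; rewrite mem_cat !inE -orbA => /or3P[/eqP->|/eqP->|/chordsBP[i iq ->]]
  /=.
- rewrite mulr_gt0 ?s1//; first by lia.
  rewrite (_ : (16 * q).+1 = 1 + 4 * (2 * (2 * q)))%N; last by lia.
  by rewrite sinf_add// exprM sqrrN expr1n expr1n mul1r s2.
(* This parameter lies just past 2b, where both sines are negative. *)
- rewrite (_ : 16 * q + 4 = 2 + 2 * b * 1)%N; last by lia.
  rewrite sinf_add// (_ : (2 + _).+1 = 1 + 4 * (2 * (2 * q) + 1))%N;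
    last by lia.
  rewrite sinf_add// exprD exprM sqrrN expr1n expr1n mul1r expr1.
  by rewrite !mulN1r mulrNN mulr_gt0 ?s1 ?s2//; lia.
- rewrite mulr_gt0 ?s1//; first by lia.
  rewrite (_ : (8 * i + 2).+1 = 3 + 4 * (2 * i))%N; last by lia.
  by rewrite sinf_add// exprM sqrrN expr1n expr1n mul1r s2.
Qed.

End Diagram.

(** * Routes and arcs *)

Section RouteAndArcs.
Variable R : realType.
Implicit Types (D : twisted_knot_diagram R) (B K w : seq R) (s t g h : R).

(** Forgetting the virtual crossings leaves a subsequence of the parameters that [params_uniq] makes
    distinct. *)
Lemma uniq_route D : uniq (route D).
Proof.
have := params_uniq D; rewrite sort_uniq !map_cat => /subseq_uniq; apply.
rewrite -!catA; apply: cat_subseq; first exact: subseq_refl.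
apply: subseq_trans (suffix_subseq _ _).
apply: cat_subseq; first exact: subseq_refl.
exact: suffix_subseq.
Qed.

(** The way back from [t] to [s] passes the origin of the parameter, whence the order [w3 ++ w1]. *)
Lemma route_between_cat D s t w1 w2 w3 : route D = w1 ++ s :: w2 ++ t :: w3 ->
  route_between D s t = w2 /\ route_between D t s = w3 ++ w1.
Proof.
move=> rE; have := uniq_route D; rewrite /route_between rE => u.
have rot_pivot (x : R) v1 v2 : x \notin v1 ->
    rot (index x (v1 ++ x :: v2)).+1 (v1 ++ x :: v2) = v2 ++ rcons v1 x.
  by move=> xv1; rewrite index_pivot//
    -cat_rcons -(size_rcons v1 x) rot_size_cat.
have [s1 sw] : s \notin w1 /\ s \notin w2 ++ t :: w3.
  move: u; rewrite cat_uniq /= => /and3P[_ + /andP[-> _]].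
  by rewrite negb_or => /andP[].
have : uniq ((w1 ++ s :: w2) ++ t :: w3) by rewrite -catA.
rewrite cat_uniq /= negb_or => /and3P[_ /andP[t1 _] /andP[t3 _]]; split.
  rewrite rot_pivot// -catA take_pivot//.
  by move: t1; rewrite mem_cat inE !negb_or => /and3P[].
rewrite -cat_cons catA rot_pivot//.
rewrite rcons_cat rcons_cons catA take_pivot// mem_cat negb_or s1 andbT.
by move: sw; rewrite mem_cat inE !negb_or => /and3P[].
Qed.

Lemma cut_at_nobar B K : ~~ has (mem B) K -> cut_at B K = [:: K].
Proof.
by elim: K => //= t K IH; rewrite negb_or => /andP[/negbTE-> /IH->].
Qed.

Lemma cut_at_cat B g w K : ~~ has (mem B) w -> g \in B ->
  cut_at B (w ++ g :: K) = w :: cut_at B K.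
Proof.
move=> + gB; elim: w => [|t w IH] /=; first by rewrite gB.
by rewrite negb_or => /andP[/negbTE-> /IH->].
Qed.

(** Each smoothing used below puts one of the three bars on one component and two on the other, so
    this case and the next suffice. *)
Lemma arcs_one_bar B g w1 w2 : ~~ has (mem B) w1 -> g \in B ->
  ~~ has (mem B) w2 -> arcs B (w1 ++ g :: w2) = [:: w1 ++ w2].
Proof.
move=> h1 gB h2; rewrite /arcs cut_at_cat// cut_at_nobar//=.
by rewrite cats0.
Qed.

Lemma arcs_two_bars B g h w1 w2 w3 : ~~ has (mem B) w1 -> g \in B ->
  ~~ has (mem B) w2 -> h \in B -> ~~ has (mem B) w3 ->
  arcs B (w1 ++ g :: w2 ++ h :: w3) = [:: w3 ++ w1; w2].
Proof.
by move=> *; rewrite /arcs !cut_at_cat// cut_at_nobar.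
Qed.

End RouteAndArcs.

(** * The indices *)

Section Indices.
Variables (R : realType) (q : nat).
Hypothesis q_gt0 : (0 < q)%N.
Let N := (8 * (8 * q).+1)%N.
Let D := lissajous R q_gt0.

(** The ends of B-chords are the numbers congruent to 2 modulo 8 below 32q + 4, except 16q + 2, the
    fixed point of p -> 32q + 4 - p, which exchanges the two ends. *)
Definition on_route (p : nat) : bool :=
  [&& p %% 8 == 2, p < 32 * q + 4 & p != 16 * q + 2]%N
  || (p \in [:: 16 * q; 16 * q + 4; 48 * q + 4; 48 * q + 8]%N ++ bar_points q).

(** Filtering an interval yields stretches of the route already in increasing order. *)
Definition leg (a c : nat) : seq nat := [seq p <- index_iota a c | on_route p].

Lemma mem_leg a c p : (p \in leg a c) = (a <= p < c)%N && on_route p.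
Proof. by rewrite mem_filter mem_index_iota andbC. Qed.

Lemma leg_split p a c : (a <= p < c)%N -> on_route p ->
  leg a c = leg a p ++ p :: leg p.+1 c.
Proof.
move=> /andP[ap pc] rp; rewrite /leg.
have -> : index_iota a c = index_iota a p ++ p :: index_iota p.+1 c.
  rewrite /index_iota -[(c - a)%N](_ : (p - a) + (c - p).-1.+1 = _)%N;
    last by lia.
  by rewrite iotaD subnKC//= (_ : (c - p).-1 = c - p.+1)%N//; lia.
by rewrite filter_cat /= rp.
Qed.

Lemma on_route_bar_points p : p \in bar_points q -> on_route p.
Proof. by move=> pm; rewrite /on_route mem_cat pm !orbT. Qed.

Lemma on_route_chords x : x \in chords q -> on_route x.1 && on_route x.2.
Proof.
rewrite mem_cat !inE -orbA => /or3P[/eqP->|/eqP->|/chordsBP[i iq ->]];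
by rewrite /on_route !inE /=; lia.
Qed.

Lemma routeE : route D = sort <=%R (map (param R q)
  (map fst (chords q) ++ map snd (chords q) ++ bar_points q)).
Proof.
rewrite (map_cat _ (map fst (chords q))) (map_cat _ (map snd (chords q))).
by rewrite -map_fst_param2 -map_snd_param2.
Qed.

Lemma perm_route : perm_eq
  (map fst (chords q) ++ map snd (chords q) ++ bar_points q) (leg 0 N).
Proof.
apply: uniq_perm.
- by have := uniq_route D; rewrite routeE sort_uniq; exact: map_uniq.
- by rewrite filter_uniq// iota_uniq.
- move=> p; rewrite mem_leg !mem_cat; apply/idP/idP.
    case/or3P => [/mapP[[s r] xC ->]|/mapP[[s r] xC ->]|].
    + rewrite (andP (on_route_chords xC)).1 andbT.
      by have := chords_double_pair q_gt0 xC; rewrite /double_pair /N/=; lia.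
    + rewrite (andP (on_route_chords xC)).2 andbT.
      by have := chords_double_pair q_gt0 xC; rewrite /double_pair /N/=; lia.
    + by rewrite /on_route !inE /N; lia.
  move=> /andP[pN]; rewrite /on_route mem_cat => /orP[/and3P[p2 p4 p6]|/orP[|->]];
    last by rewrite !orbT.
    (* Below the fixed point [p] is the first end of its B-chord, above it the second. *)
    case: (ltnP p (16 * q + 2)) => pq.
      have pC : (p, 32 * q + 4 - p)%N \in chords q.
        rewrite mem_cat; apply/orP; right; apply/chordsBP; exists (p %/ 8)%N;
          first by lia.
        by congr pair; lia.
      by rewrite (map_f fst pC).
    have pC : (32 * q + 4 - p, p)%N \in chords q.
      rewrite mem_cat; apply/orP; right; apply/chordsBP;
        exists ((32 * q + 4 - p) %/ 8)%N; first by lia.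
      by congr pair; lia.
    by rewrite (map_f snd pC) orbT.
  by rewrite !inE => /or4P[] /eqP->; rewrite ?eqxx ?orbT.
Qed.

Lemma route_lissajous : route D = map (param R q) (leg 0 N).
Proof.
rewrite routeE -[RHS]sort_le_id.
  apply/perm_sortP; [exact: le_total|exact: le_trans|exact: le_anti|].
  exact/perm_map/perm_route.
rewrite sorted_map; apply: (@sub_sorted _ ltn) => [x y /= /ltnW|].
  by rewrite ler_param.
by rewrite sorted_filter ?iota_ltn_sorted//; exact: ltn_trans.
Qed.

Lemma route_between_lissajous p r : (p < r < N)%N -> on_route p -> on_route r ->
  route_between D (param R q p) (param R q r) = map (param R q) (leg p.+1 r) /\
  route_between D (param R q r) (param R q p)
    = map (param R q) (leg r.+1 N ++ leg 0 p).
Proof.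
move=> /andP[pr rN] rp rr; rewrite map_cat.
apply: route_between_cat; rewrite route_lissajous.
rewrite (@leg_split p)//; last by lia.
rewrite (@leg_split r p.+1)//; last by lia.
by rewrite map_cat /= map_cat.
Qed.

Lemma no_bar_points (K : seq nat) : (forall p,
  p \in bar_points q -> p \notin K) ->
  ~~ has (mem (map (param R q) (bar_points q))) (map (param R q) K).
Proof.
move=> mK; rewrite has_map; apply/hasPn => p pK.
rewrite -[X in ~~ X]/(param R q p \in map (param R q) (bar_points q)) mem_map;
  last exact: param_inj.
by apply/negP => /mK; rewrite pK.
Qed.

(** All signs being 1, the signed sums are cardinals, computed with predicates on pairs of
    naturals. *)
Lemma linking_index_count x0 (L : two_component_diagram R) Cs
  (P Q : pred (nat * nat)) :
  crossings L = rem (param2 R q x0) (map (param2 R q) (chords q)) ->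
  (forall y, y \in chords q -> let x := param2 R q y in
    let l := (y != x0) && ((x.1 \in component1 L) && (x.2 \in component2 L)
     || (x.1 \in component2 L) && (x.2 \in component1 L)) in
    (l && Defs.alternating (@over_on R) (@under_on R) Cs x = P y) /\
    (l && Defs.alternating (@under_on R) (@over_on R) Cs x = Q y)) ->
  linking_index D L Cs = (count P (chords q))%:Z - (count Q (chords q))%:Z.
Proof.
move=> LE PQ.
have sum_count (S : seq (R * R)) T :
    S = map (param2 R q) [seq y <- chords q | T y] ->
    \sum_(x <- S) crossing_sgn D x = (count T (chords q))%:Z.
  move=> ->; rewrite big_map big_filter big_seq_cond.
  under eq_bigr => y /andP[yC _] do rewrite crossing_sgn_lissajous//.
  by rewrite -big_seq_cond big_const_seq iter_addr addr0 natz.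
have sublist (f : R * R -> bool) T :
    (forall y, y \in chords q -> let x := param2 R q y in
      (y != x0) && ((x.1 \in component1 L) && (x.2 \in component2 L)
       || (x.1 \in component2 L) && (x.2 \in component1 L)) && f x = T y) ->
    [seq x <- linking_crossings L | f x]
    = map (param2 R q) [seq y <- chords q | T y].
  move=> fT; rewrite /linking_crossings LE rem_filter; last first.
    by rewrite map_inj_uniq ?uniq_chords//; exact: param2_inj.
  rewrite -!filter_predI filter_map; congr map; apply: eq_in_filter => y yC /=.
  rewrite -fT//= (inj_eq (@param2_inj R q)) andbC -andbA; congr andb.
  by rewrite andbC.
rewrite /linking_index; congr (_ - _);
by apply/sum_count/sublist => y /PQ[].
Qed.

(** Comparing the first end with 16q separates the two families of [chords]. *)
Lemma count_chordsB : count (fun y : nat * nat => (y.1 < 16 * q)%N) (chords q)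
  = (2 * q)%N.
Proof.
rewrite count_cat /= ltnn (_ : _ < _ = false)%N; last by lia.
rewrite !add0n -[RHS](size_iota 0) -(size_map (fun i => (8 * i + 2,
  32 * q + 2 - 8 * i)%N)).
apply/eqP; rewrite -all_count; apply/allP => y /chordsBP[i iq ->] /=; lia.
Qed.

Lemma count_chordsA : count (fun y : nat * nat => (16 * q <= y.1)%N) (chords q)
  = 2.
Proof.
rewrite count_cat /= leqnn leq_addr (_ : count _ (chordsB q) = 0)%N//.
by apply/eqP; rewrite -leqn0 leqNgt -has_count;
  apply/hasPn => y /chordsBP[i iq ->] /=; lia.
Qed.

Lemma mem_map_param p (K : seq nat) :
  (param R q p \in map (param R q) K) = (p \in K).
Proof. by rewrite mem_map//; exact: param_inj. Qed.

Definition smoothed (p r : nat) : two_component_diagram R :=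
  {| component1 := map (param R q) (leg p.+1 r) ;
     component2 := map (param R q) (leg r.+1 N ++ leg 0 p) ;
     crossings := rem (param2 R q (p, r)) (map (param2 R q) (chords q)) ;
     link_bars := map (param R q) (bar_points q) |}.

Lemma smoothing_lissajous p r : (p, r) \in chords q ->
  smoothing D (param2 R q (p, r)) = smoothed p r.
Proof.
move=> pr; have /andP[/= rp rr] := on_route_chords pr.
have prN : (p < r < N)%N.
  by have := chords_double_pair q_gt0 pr; rewrite /double_pair /N/=; lia.
by rewrite /smoothing /param2 /=;
  have [-> ->] := route_between_lissajous prN rp rr.
Qed.

(** A crossing links the components of the smoothing at (p, r) exactly when its chord has one end
    strictly between [p] and [r] and the other outside [p, r]. *)
Lemma linking_index_smoothed p r Cs (P Q : pred (nat * nat)) :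
  (forall y1 y2, (y1, y2) \in chords q ->
    let l := ((y1, y2) != (p, r)) &&
      ((p < y1 < r) && ~~ (p <= y2 <= r) || ~~ (p <= y1 <= r) && (p < y2 < r))%N in
    let x := param2 R q (y1, y2) in
    (l && Defs.alternating (@over_on R) (@under_on R) Cs x = P (y1, y2)) /\
    (l && Defs.alternating (@under_on R) (@over_on R) Cs x = Q (y1, y2))) ->
  linking_index D (smoothed p r) Cs
    = (count P (chords q))%:Z - (count Q (chords q))%:Z.
Proof.
move=> PQ; apply: (@linking_index_count (p, r)) => // -[y1 y2] yC /=.
rewrite !mem_map_param !mem_cat !mem_leg.
have /andP[/= -> ->] := on_route_chords yC; rewrite !andbT.
have [y1N y2N] : (y1 < N)%N /\ (y2 < N)%N.
  by have := chords_double_pair q_gt0 yC; rewrite /double_pair /N/=; lia.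
have outside a : (a < N)%N ->
    (r < a < N)%N || (0 <= a < p)%N = ~~ (p <= a <= r)%N.
  by lia.
by rewrite !outside//; exact: PQ.
Qed.

Lemma chordsP y1 y2 : (y1, y2) \in chords q ->
  (y1 = 16 * q /\ y2 = 48 * q + 8 \/ y1 = 16 * q + 4 /\ y2 = 48 * q + 4 \/
   y1 < 16 * q /\ y1 %% 8 = 2 /\ y1 + y2 = 32 * q + 4)%N.
Proof.
rewrite mem_cat !inE -orbA => /or3P[/eqP[-> ->]|/eqP[-> ->]|].
- by left.
- by right; left.
- by move=> /chordsBP[i iq [-> ->]]; right; right; lia.
Qed.

(** The linking crossings are the B-chords. This component meets their far, under ends, between its
    two bars, hence on the second arc, where under passages count in [O_L]. *)
Lemma Ind1_chordsA p r : (p, r) \in chords q -> (16 * q <= p)%N ->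
  Ind1 D (param2 R q (p, r)) = (2 * q)%:Z.
Proof.
move=> prC pq; have prP := chordsP prC.
rewrite /Ind1 smoothing_lissajous//=.
have -> : leg p.+1 r = leg p.+1 (16 * q + 7) ++ (16 * q + 7)%N ::
    leg (16 * q + 8) (48 * q + 3) ++ (48 * q + 3)%N :: leg (48 * q + 4) r.
  rewrite (@leg_split (16 * q + 7) p.+1 r);
    [|lia|by rewrite on_route_bar_points// !inE eqxx ?orbT].
  rewrite (@leg_split (48 * q + 3) (16 * q + 7).+1 r);
    [|lia|by rewrite on_route_bar_points// !inE eqxx ?orbT].
  by rewrite -!addnS.
rewrite map_cat map_cons map_cat map_cons arcs_two_bars ?mem_map_param ?inE
  ?eqxx ?orbT//;
  try by apply: no_bar_points => g; rewrite mem_leg !inE; lia.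
rewrite (@linking_index_smoothed _ _ _ (fun y => y.1 < 16 * q)%N pred0).
  by rewrite count_chordsB count_pred0 subr0.
move=> y1 y2 yC; have yP := chordsP yC;
  have /andP[/= ry1 ry2] := on_route_chords yC.
rewrite /= /over_on /under_on /= !mem_cat !mem_map_param !mem_leg ry1 ry2
  xpair_eqE.
by clear - prP yP pq; lia.
Qed.

(** This component meets the first, over ends of the B-chords and has one bar, so its single arc
    puts them all in [O_L]. *)
Lemma Ind2_chordsA p r : (p, r) \in chords q -> (16 * q <= p)%N ->
  Ind2 D (param2 R q (p, r)) = (2 * q)%:Z.
Proof.
move=> prC pq; have prP := chordsP prC.
rewrite /Ind2 smoothing_lissajous//=.
have -> : leg r.+1 N ++ leg 0 p = leg r.+1 (48 * q + 11) ++ (48 * q + 11)%N ::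
    (leg (48 * q + 11).+1 N ++ leg 0 p).
  by rewrite (@leg_split (48 * q + 11) r.+1 N) ?on_route_bar_points ?inE ?eqxx
    ?orbT// -?catA//; rewrite /N; lia.
rewrite map_cat map_cons (@arcs_one_bar _ _ (param R q (48 * q + 11)))
  ?mem_map_param ?inE ?eqxx ?orbT//;
  try by apply: no_bar_points => g; rewrite ?mem_cat !mem_leg !inE; lia.
rewrite (@linking_index_smoothed _ _ _ (fun y => y.1 < 16 * q)%N pred0).
  by rewrite count_chordsB count_pred0 subr0.
move=> y1 y2 yC; have yP := chordsP yC;
  have /andP[/= ry1 ry2] := on_route_chords yC.
rewrite /= /over_on /under_on /= !mem_cat !mem_map_param !mem_cat !mem_leg ry1
  ry2 xpair_eqE.
by clear - prP yP pq; rewrite /N; lia.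
Qed.

(** Now the linking crossings are the two A-chords, met here as over passages on a single arc. *)
Lemma Ind1_chordsB p r : (p, r) \in chords q -> (p < 16 * q)%N ->
  Ind1 D (param2 R q (p, r)) = 2.
Proof.
move=> prC pq; have prP := chordsP prC.
rewrite /Ind1 smoothing_lissajous//=.
have -> : leg p.+1 r = leg p.+1 (16 * q + 7) ++
    (16 * q + 7)%N :: leg (16 * q + 7).+1 r.
  by rewrite (@leg_split (16 * q + 7) p.+1 r) ?on_route_bar_points ?inE ?eqxx
    ?orbT//; lia.
rewrite map_cat map_cons (@arcs_one_bar _ _ (param R q (16 * q + 7)))
  ?mem_map_param ?inE ?eqxx ?orbT//;
  try by apply: no_bar_points => g; rewrite ?mem_cat !mem_leg !inE; lia.
rewrite (@linking_index_smoothed _ _ _ (fun y => 16 * q <= y.1)%N pred0).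
  by rewrite count_chordsA count_pred0 subr0.
move=> y1 y2 yC; have yP := chordsP yC;
  have /andP[/= ry1 ry2] := on_route_chords yC.
rewrite /= /over_on /under_on /= !mem_cat !mem_map_param !mem_leg ry1 ry2
  xpair_eqE.
by clear - prP yP pq; lia.
Qed.

(** The far, under ends of the A-chords lie between the two bars of this component, so the
    alternation again puts them in [O_L]. *)
Lemma Ind2_chordsB p r : (p, r) \in chords q -> (p < 16 * q)%N ->
  Ind2 D (param2 R q (p, r)) = 2.
Proof.
move=> prC pq; have prP := chordsP prC.
rewrite /Ind2 smoothing_lissajous//=.
have -> : leg r.+1 N ++ leg 0 p = leg r.+1 (48 * q + 3) ++ (48 * q + 3)%N ::
    leg (48 * q + 3).+1 (48 * q + 11) ++ (48 * q + 11)%N ::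
    (leg (48 * q + 11).+1 N ++ leg 0 p).
  rewrite (@leg_split (48 * q + 3) r.+1 N) ?on_route_bar_points ?inE ?eqxx
    ?orbT//; last by rewrite /N; lia.
  rewrite (@leg_split (48 * q + 11) (48 * q + 3).+1 N) ?on_route_bar_points
    ?inE ?eqxx ?orbT//; last by rewrite /N; lia.
  by rewrite -!(catA, cat_cons).
rewrite map_cat map_cons map_cat map_cons arcs_two_bars ?mem_map_param ?inE
  ?eqxx ?orbT//;
  try by apply: no_bar_points => g; rewrite ?mem_cat !mem_leg !inE; lia.
rewrite (@linking_index_smoothed _ _ _ (fun y => 16 * q <= y.1)%N pred0).
  by rewrite count_chordsA count_pred0 subr0.
move=> y1 y2 yC; have yP := chordsP yC;
  have /andP[/= ry1 ry2] := on_route_chords yC.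
rewrite /= /over_on /under_on /= !mem_cat !mem_map_param !mem_cat !mem_leg ry1
  ry2 xpair_eqE.
by clear - prP yP pq; rewrite /N; lia.
Qed.

(** Each of the 2 A-crossings contributes t^(2q + 2q) - 1 and each of the 2q B-crossings t^(2 + 2) -
    1. *)
Lemma B_index_polynomial_lissajous : B_index_polynomial D
  = 2%:R * tvar ^+ (4 * q) + (2 * q)%:R * tvar ^+ 4 - (2 * q.+1)%:R.
Proof.
have term p r k : (p, r) \in chords q ->
    Ind1 D (param2 R q (p, r)) = k%:Z -> Ind2 D (param2 R q (p, r)) = k%:Z ->
    (crossing_sgn D (param2 R q (p, r)))%:~R
     * (tvar ^ (Ind1 D (param2 R q (p, r)) + Ind2 D (param2 R q (p, r))) - 1)
    = tvar ^+ (2 * k) - 1.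
  move=> prC -> ->; rewrite crossing_sgn_lissajous// mul1r -PoszD exprnP.
  by rewrite addnn mul2n.
have inA y : y \in chordsA q -> y \in chords q by rewrite mem_cat => ->.
have inB y : y \in chordsB q -> y \in chords q by rewrite mem_cat orbC => ->.
rewrite /B_index_polynomial big_map big_cat /= !big_cons big_nil.
rewrite !(term _ _ (2 * q)%N) ?inA ?Ind1_chordsA ?Ind2_chordsA ?inA ?inE ?eqxx
  ?orbT ?leq_addr//.
rewrite big_seq (eq_bigr (fun=> tvar ^+ 4 - 1)); last first.
  move=> [p r] yB; have yC := inB _ yB.
  have pq : (p < 16 * q)%N by move: yB => /chordsBP[i iq [-> _]]; lia.
  by rewrite (term _ _ 2%N) ?Ind1_chordsB ?Ind2_chordsB.
rewrite -big_seq big_const_seq count_predT size_map size_iota iter_addr_0.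
rewrite mulnA -[in LHS]mulr_natl !natrM -natr1; ring.
Qed.

End Indices.

Theorem proposition3p16 (R : realType) (n : nat) (hn : (1 < n)%N) :
  exists D : twisted_knot_diagram R,
    B_index_polynomial D
    = 2%:R * tvar ^+ (4 * (n - 1)) + (2 * (n - 1))%:R * tvar ^+ 4
      - (2 * n)%:R.
Proof.
have q_gt0 : (0 < n - 1)%N by rewrite subn_gt0.
exists (lissajous R q_gt0); rewrite B_index_polynomial_lissajous.
have nE : (n - 1).+1 = n by rewrite subn1 prednK// ltnW.
by rewrite nE.
Qed.
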